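(* Let $q\ge 2$ be an integer and let $T$ be the infinite homogeneous tree in which every vertex has exactly $q+1$ neighbours, with a fixed root $0$, viewed as an electric network with conductance $1$ (hence resistance $1$) on every edge. Let $i=\lim_n i_n$ and $v=\lim_n v_n$ be the pointwise limits of the unit current flows $i_n$ from $0$ to $z_n$ and of the corresponding voltages $v_n$ with $v_n(z_n)=0$, for a sequence $(G_n)_{n\ge 0}$ of finite subgraphs containing $0$ that exhausts $T$ (as described in the context). Then: (a) for all $x,y\in T$ with $y\sim x$, $$i(x,y)=\begin{cases}\dfrac{1}{q+1}\cdot\dfrac{1}{q^{|x|}}, & \text{if } |y|>|x|,\\[2mm] -\dfrac{1}{q+1}\cdot\dfrac{1}{q^{|x|-1}}, & \text{if } |y|<|x|;\end{cases}$$ (b) for all $x\in T$, $$v(x)=\frac{q}{q^2-1}\,q^{-|x|}.$$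
   Context: $T$ also denotes the vertex set of the tree; $y\sim x$ means that $x,y$ are neighbours; $d(x,y)$ is the number of edges of the geodesic path from $x$ to $y$, and $|x|=d(0,x)$. Exhaustion: $(G_n)_{n\ge 0}$ is an increasing sequence of finite subgraphs of $T$, each containing $0$, whose union is $T$. For each $n$, all vertices of $T$ outside $G_n$ are contracted to a single vertex $z_n$ (resulting loops are discarded, multiple edges are kept, each edge retaining conductance $1$), giving a finite network $G^{(n)}$. Current and voltage: $i_n$ is the unit current flow in $G^{(n)}$ from $0$ to $z_n$, and $v_n$ is the corresponding voltage function on the vertices of $G^{(n)}$ with $v_n(z_n)=0$. That is, $i_n$ is an antisymmetric function on the oriented edges ($i_n(\breve e)=-i_n(e)$, where $\breve e$ is the reversed edge) such that: Ohm's law $v_n(e^-)-v_n(e^+)=i_n(e)\,r(e)$ holds for each oriented edge $e$ with tail $e^-$ and head $e^+$ (here $r(e)=1$); Kirchhoff's law $\sum_{e^-=x} i_n(e)=0$ holds for every vertex $x\ne 0,z_n$; and $\sum_{e^-=0} i_n(e)=1$. For an oriented edge $(x,y)$ of $T$, $i_n(x,y)$ is considered for all $n$ large enough that $x,y\in G_n$, and similarly $v_n(x)$ for all $n$ large enough that $x\in G_n$; the limits are taken as $n\to\infty$. *)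

(* Defs.v *)
From HB Require Import structures.
From mathcomp Require Import all_boot all_order all_algebra.
From mathcomp Require Import finmap.
From mathcomp Require Import all_classical all_reals all_analysis.

Set Implicit Arguments.
Unset Strict Implicit.
Unset Printing Implicit Defensive.

Import Order.TTheory GRing.Theory Num.Theory.
Import numFieldNormedType.Exports.

Local Open Scope classical_set_scope.
Local Open Scope card_scope.
Local Open Scope ring_scope.

Record tree := Tree {
  vertex :> choiceType;
  adj : rel vertex;
  adj_sym : symmetric adj;
  adj_irr : irreflexive adj;
  adj_connected : forall x y : vertex, exists p, path adj x p /\ last x p = y;
  adj_acyclic : forall c : seq vertex, (2 < size c)%N -> ~ ucycle adj c }.

(* Every vertex has exactly [d] neighbours. *)
Definition homogeneous (T : tree) (d : nat) : Prop :=
  forall x : T, [set y : T | adj x y] #= `I_d.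

Section Distance.
Variable T : tree.

Definition joined_in (x y : T) : pred nat :=
  fun n => `[< exists p, [/\ path (@adj T) x p, last x p = y & size p = n] >].

Lemma joined_in_ex (x y : T) : exists n, joined_in x y n.
Proof.
have [p [xp py]] := adj_connected x y.
by exists (size p); apply/asboolP; exists p.
Qed.

Definition dist (x y : T) : nat := ex_minn (joined_in_ex x y).

End Distance.

(* [sub_edge] is a symmetric set of edges, not necessarily the induced one. *)
Record finite_subgraph (T : tree) := FiniteSubgraph {
  sub_verts : {fset T};
  sub_edge : rel T;
  sub_edge_sym : symmetric sub_edge;
  sub_edge_adj : forall x y, sub_edge x y -> adj x y;
  sub_edge_verts : forall x y, sub_edge x y -> x \in sub_verts }.

Definition subgraph_le (T : tree) (G H : finite_subgraph T) : Prop :=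
  (forall x, x \in sub_verts G -> x \in sub_verts H) /\
  (forall x y, sub_edge G x y -> sub_edge H x y).

Record exhaustion (T : tree) (o : T) (G : nat -> finite_subgraph T) : Prop :=
  Exhaustion {
    exhaustion_incr : forall m n, (m <= n)%N -> subgraph_le (G m) (G n);
    exhaustion_root : forall n, o \in sub_verts (G n);
    exhaustion_verts : forall x, exists n, x \in sub_verts (G n);
    exhaustion_edges : forall x y, adj x y -> exists n, sub_edge (G n) x y }.

(* Possibly infinite networks, possibly with multiple edges: each edge is
   represented by its two orientations, exchanged by [flip]. *)
Record network (R : realType) := Network {
  node : choiceType;
  oedge : choiceType;
  src : oedge -> node;
  dst : oedge -> node;
  flip : oedge -> oedge;
  cond : oedge -> R;
  flipK : involutive flip;
  src_flip : forall e, src (flip e) = dst e;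
  cond_gt0 : forall e, 0 < cond e;
  cond_flip : forall e, cond (flip e) = cond e }.

Section TreeNetwork.
Variables (R : realType) (T : tree).

Definition tree_edge : choiceType := {e : T * T | adj e.1 e.2}.

Definition mk_edge (x y : T) (xy : adj x y) : tree_edge := exist _ (x, y) xy.

Definition tree_flip (e : tree_edge) : tree_edge :=
  @mk_edge (val e).2 (val e).1 (etrans (adj_sym _ _) (valP e)).

Lemma tree_flipK : involutive tree_flip.
Proof. by case=> -[x y] xy; apply: val_inj. Qed.

Definition tree_network : network R :=
  @Network R T tree_edge (fun e => (val e).1) (fun e => (val e).2) tree_flip
    (fun=> 1) tree_flipK (fun=> erefl) (fun=> ltr01) (fun=> erefl).

End TreeNetwork.

(* [contract N A] is [N] with all nodes outside [A] identified to the single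
   node [None]. The quotient map on nodes is [insub], which sends x to [Some x]
   if x \in A and to [None] otherwise; an edge is kept iff it is not a loop in
   the quotient, so that parallel edges remain distinct. *)
Section Contract.
Variables (R : realType) (N : network R) (A : {fset node N}).

Definition contract_node : choiceType := option A.

Definition proj_node (x : node N) : contract_node := insub x.

Definition contract_edge : choiceType :=
  {e : oedge N | proj_node (src e) != proj_node (dst e)}.

Lemma dst_flip (e : oedge N) : dst (flip e) = src e.
Proof. by rewrite -src_flip flipK. Qed.

Lemma contract_flip_subproof (e : contract_edge) :
  proj_node (src (flip (val e))) != proj_node (dst (flip (val e))).
Proof. by rewrite src_flip dst_flip eq_sym (valP e). Qed.

Definition contract_flip (e : contract_edge) : contract_edge :=
  exist _ (flip (val e)) (contract_flip_subproof e).

Lemma contract_flipK : involutive contract_flip.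
Proof. by move=> e; apply: val_inj; rewrite /= flipK. Qed.

Lemma contract_src_flip (e : contract_edge) :
  proj_node (src (val (contract_flip e))) = proj_node (dst (val e)).
Proof. by rewrite /= src_flip. Qed.

Definition contract : network R :=
  @Network R contract_node contract_edge
    (fun e => proj_node (src (val e))) (fun e => proj_node (dst (val e)))
    contract_flip (fun e => cond (val e)) contract_flipK contract_src_flip
    (fun e => cond_gt0 (val e)) (fun e => cond_flip (val e)).

End Contract.

(* [i] is the unit current flow from [a] to [z] and [v] its voltage, grounded
   at [z]. The sums are finitely supported sums, equal to 0 by convention when
   the support is infinite; this never happens in the finite networks
   obtained by contracting a locally finite one. *)
Record unit_current (R : realType) (N : network R) (a z : node N)
    (i : oedge N -> R) (v : node N -> R) : Prop := UnitCurrent {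
  current_anti : forall e, i (flip e) = - i e;
  ohm_law : forall e, v (src e) - v (dst e) = i e * (cond e)^-1;
  kirchhoff_law : forall x, x != a -> x != z ->
    \sum_(e \in [set e : oedge N | src e = x]) i e = 0;
  current_unit : \sum_(e \in [set e : oedge N | src e = a]) i e = 1;
  voltage_ground : v z = 0 }.

Section ExhaustionNetwork.
Variables (R : realType) (T : tree) (G : finite_subgraph T).

Definition wired : network R := @contract R (tree_network R T) (sub_verts G).

Definition wired_node (x : T) : node wired :=
  @proj_node R (tree_network R T) (sub_verts G) x.

Definition wired_sink : node wired := None.

(* Value of a current of the contracted network on the oriented edge (x, y) of
   the tree; the default value 0 is only used when both endpoints of the edge
   are outside [G], so it does not affect limits along an exhaustion. *)
Definition current_at (i : oedge wired -> R) (x y : T) (xy : adj x y) : R :=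
  oapp i 0 (insub (mk_edge xy) : option (oedge wired)).

End ExhaustionNetwork.

(* Main.v *)
Require Import Defs.
From HB Require Import structures.
From mathcomp Require Import all_boot all_order all_algebra.
From mathcomp Require Import finmap.
From mathcomp Require Import all_classical all_reals all_analysis.
From mathcomp Require Import ring lra.

(* With v_n extended by 0 outside G_n and g(x) = q / (q^2 - 1) q^-|x|, both v_n
   and g have Laplacian 1_{x = 0} on G_n: for g this is a computation, using
   that every x <> 0 has exactly one neighbour closer to 0 and q neighbours
   farther from it. Hence g - v_n is harmonic on G_n, and by the maximum
   principle it is bounded by the supremum of g outside G_n, which tends to 0
   because G_n eventually contains every ball. *)

Set Implicit Arguments.
Unset Strict Implicit.
Unset Printing Implicit Defensive.

Import Order.TTheory GRing.Theory Num.Theory.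
Import numFieldNormedType.Exports.

Local Open Scope classical_set_scope.
Local Open Scope ring_scope.

(** * Distances, parents and neighbours in a tree *)

Section TreeDistance.
Variable T : tree.
Implicit Types x y z o : T.

Lemma dist_path x p : path (@adj T) x p -> (dist x (last x p) <= size p)%N.
Proof.
move=> xp; rewrite /dist; case: ex_minnP => m _; apply.
by apply/asboolP; exists p.
Qed.

Lemma distP x y : exists p, [/\ path (@adj T) x p, last x p = y & size p = dist x y].
Proof. by rewrite /dist; case: ex_minnP => m /asboolP. Qed.

Lemma dist_refl x : dist x x = 0%N.
Proof. by apply/eqP; rewrite -leqn0; exact: (@dist_path x [::]). Qed.

Lemma dist_eq0 x y : dist x y = 0%N -> y = x.
Proof. by have [p [_ <- <-]] := distP x y; case: p. Qed.

Lemma dist_adj o x y : adj x y -> (dist o y <= (dist o x).+1)%N.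
Proof.
move=> xy; have [p [op px <-]] := distP o x.
have := @dist_path o (rcons p y); rewrite last_rcons size_rcons; apply.
by rewrite rcons_path op px.
Qed.

Lemma dist_parent o x : x != o -> exists2 y, adj x y & dist o x = (dist o y).+1.
Proof.
move=> xo; have [p [op px sp]] := distP o x.
case/lastP: p => [|p z] in op px sp *; first by rewrite -px eqxx in xo.
rewrite last_rcons in px; subst z.
move: op; rewrite rcons_path => /andP[op yx]; rewrite size_rcons in sp.
exists (last o p); first by rewrite adj_sym.
by apply/eqP; rewrite eqn_leq dist_adj //= -sp ltnS dist_path.
Qed.

(** Descending from [y] through parents, the distance to [o] drops strictly below [dist o x], so [x]
    is never met. *)
Lemma path_avoiding o x y : y != x -> (dist o y <= dist o x)%N ->
  exists p, path [rel u v : T | adj u v && (v != x)] o p /\ last o p = y.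
Proof.
have [n] := ubnP (dist o y); elim: n y => // n IH y yn yx yox.
have [->|yo] := eqVneq y o; first by exists [::].
have [z yz dy] := dist_parent yo.
have [|||p [op pz]] := IH z.
- by rewrite dy in yn.
- by apply: contraTneq yox => <-; rewrite dy ltnn.
- by rewrite (leq_trans _ yox) // dy.
exists (rcons p y); rewrite rcons_path op pz last_rcons /= yx andbT.
by split => //; rewrite adj_sym.
Qed.

(* Two such neighbours, joined through [o] by a path avoiding [x], would close
   up to a cycle through [x]. *)
Lemma neighbor_not_farther_unique o x y z : adj x y -> adj x z ->
  (dist o y <= dist o x)%N -> (dist o z <= dist o x)%N -> y = z.
Proof.
move=> xy xz yx zx; apply/eqP/negPn/negP => yz.
have nx u : adj x u -> u != x by apply: contraTneq => ->; rewrite adj_irr.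
have [p [py py']] := path_avoiding (nx _ xy) yx.
have [r [pz pz']] := path_avoiding (nx _ xz) zx.
(* Excluding [x] at both ends of a step makes the relation symmetric, so that the path from [o] to
   [y] can be reversed. *)
pose e : rel T := fun u v => [&& adj u v, u != x & v != x].
have [ox|ox] := eqVneq o x.
  by move: yx (nx _ xy); rewrite -ox dist_refl leqn0 => /eqP/dist_eq0 ->; rewrite eqxx.
have toe w s : w != x -> path [rel u v : T | adj u v && (v != x)] w s -> path e w s.
  elim: s w => //= u s IH w wx /andP[/andP[wu ux] us].
  by rewrite /e wu wx ux IH.
have es : symmetric e by move=> u v; rewrite /e adj_sym [(u != x) && _]andbC.
have yo : path e y (rev (belast o p)).
  by rewrite -py' rev_path (eq_path (e' := e)) ?toe // => u v; rewrite es.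
have lo : last y (rev (belast o p)) = o.
  case: (p) py' => [<- //|u s] _; by rewrite /= rev_cons last_rcons.
have : path e y (rev (belast o p) ++ r) by rewrite cat_path yo lo toe.
move: (last_cat y (rev (belast o p)) r); rewrite lo pz' => + yr.
(* The walk from [y] through [o] to [z] may repeat vertices. Its simple shortening has at least one
   step because [y] and [z] differ, so adding [x] gives a cycle on at least three vertices. *)
case/shortenP: yr => s ys us _ sz.
apply: (@adj_acyclic T (x :: y :: s)).
  by case: s sz {ys us} => //= sz; rewrite sz eqxx in yz.
have xs : x \notin s.
  elim: s y ys {us sz xy yx yz nx py' yo lo} => //= u s IH w /andP[/and3P[_ _ ux] us].
  by rewrite inE negb_or eq_sym ux (IH u).
apply/andP; split; last by rewrite /= inE eq_sym negb_or nx //= xs.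
rewrite /= rcons_path sz xy adj_sym xz andbT /=.
by apply: sub_path ys => u v /and3P[].
Qed.

(** For [x] other than the root, an equidistant neighbour would coincide with the parent of [x] by
    uniqueness, but the parent is strictly closer. *)
Lemma dist_adj_neq o x y : adj x y -> dist o y != dist o x.
Proof.
move=> xy; apply/eqP => d.
have [xo|/dist_parent[z xz dz]] := eqVneq x o.
  by move: d xy; rewrite xo dist_refl => /dist_eq0 ->; rewrite adj_irr.
have yz : y = z by apply: (neighbor_not_farther_unique (o := o) xy xz); rewrite ?d ?dz.
by move: dz; rewrite -yz d => /n_Sn.
Qed.

Lemma dist_adj_lt o x y : adj x y -> (dist o x < dist o y)%N ->
  dist o y = (dist o x).+1.
Proof. by move=> xy lt; apply/eqP; rewrite eqn_leq dist_adj. Qed.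

(** * Sums over neighbours in the homogeneous tree *)

Variable q : nat.
Hypothesis T_homogeneous : homogeneous T q.+1.

Lemma finite_neighbors x : finite_set [set y : T | adj x y].
Proof. by exists q.+1; exact: T_homogeneous. Qed.

Definition neighbors x : {fset T} := fset_set [set y : T | adj x y].

Lemma in_neighbors x y : (y \in neighbors x) = adj x y.
Proof. by rewrite in_fset_set ?mem_setE //; exact: finite_neighbors. Qed.

Lemma size_neighbors x : size (neighbors x) = q.+1.
Proof. exact: card_fset_set. Qed.

Lemma sum_neighbors_root (V : nmodType) (f : nat -> V) o :
  \sum_(y <- neighbors o) f (dist o y) = f 1%N *+ q.+1.
Proof.
rewrite big_seq (eq_bigr (fun=> f 1%N)) => [|y].
  by rewrite -big_seq big_const_seq count_predT size_neighbors iter_addr addr0.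
rewrite in_neighbors => oy; congr f.
by rewrite (dist_adj_lt oy) dist_refl // lt0n -[X in _ != X](dist_refl o) dist_adj_neq.
Qed.

(** The parent contributes [f n]; by uniqueness the other [q] neighbours are all farther from
    [o]. *)
Lemma sum_neighbors (V : nmodType) (f : nat -> V) o x n : dist o x = n.+1 ->
  \sum_(y <- neighbors x) f (dist o y) = f n + f n.+2 *+ q.
Proof.
move=> dx; have xo : x != o.
  by apply/eqP => xo; move: dx; rewrite xo dist_refl.
have [z xz] := dist_parent xo; rewrite dx => -[dz].
have zN : z \in neighbors x by rewrite in_neighbors.
rewrite (bigD1_seq z) ?fset_uniq //= -dz; congr (_ + _).
rewrite big_seq_cond (eq_bigr (fun=> f n.+2)) => [|y].
  rewrite -big_seq_cond big_const_seq iter_addr addr0; congr (_ *+ _).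
  have := count_predC (pred1 z) (neighbors x).
  by rewrite size_neighbors count_uniq_mem ?fset_uniq // zN add1n => -[].
rewrite in_neighbors => /andP[xy yz]; congr f.
rewrite (dist_adj_lt xy) ?dx // ltnNge; apply: contra yz => yx.
by apply/eqP/(neighbor_not_farther_unique (o := o) xy xz); rewrite dx // -dz.
Qed.

(** * Children, finite balls and the maximum principle *)

Hypothesis q_gt0 : (0 < q)%N.

(** Only one neighbour can fail to be farther from [o], while there are at least two in all. *)
Lemma exists_child o x : exists2 y, adj x y & (dist o x < dist o y)%N.
Proof.
apply: contrapT => nchild.
suff : (size (neighbors x) <= 1)%N by rewrite size_neighbors ltnS leqNgt q_gt0.
have far y : y \in neighbors x -> (dist o y <= dist o x)%N.
  by rewrite in_neighbors leqNgt => xy; apply/negP => lt; apply: nchild; exists y.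
have [->//|[u uN]] := fset_0Vmem (neighbors x).
apply: (@uniq_leq_size _ _ [:: u]) => [|y yN]; first exact: fset_uniq.
rewrite inE; apply/eqP/(neighbor_not_farther_unique (x := x) (o := o));
  by rewrite ?far // -in_neighbors.
Qed.

Lemma finite_ball o n : finite_set [set x | (dist o x <= n)%N].
Proof.
elim: n => [|n IH].
  apply: (sub_finite_set _ (finite_set1 o)) => x /=.
  by rewrite leqn0 => /eqP/dist_eq0.
apply: (@sub_finite_set _ _ ([set o] `|` \bigcup_(x in [set x | (dist o x <= n)%N]) [set y | adj x y])).
  move=> x /= xn; have [->|/dist_parent[y xy dy]] := eqVneq x o; first by left.
  by right; exists y => /=; rewrite 1?adj_sym // -ltnS -dy.
rewrite finite_setU; split; first exact: finite_set1.
by apply: bigcup_finite => // x _; exact: finite_neighbors.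
Qed.

(** If [h] exceeded [c] somewhere, its maximum over the finite set [A] would be global. Harmonicity
    makes every neighbour of a maximizer a maximizer, again in [A]; a child of a farthest one is
    then a contradiction. *)
Lemma maximum_principle (R : realFieldType) (A : {fset T}) (h : T -> R) (c : R) :
  (forall x, x \notin A -> h x <= c) ->
  (forall x, x \in A -> \sum_(y <- neighbors x) (h x - h y) = 0) ->
  forall x, h x <= c.
Proof.
move=> hA harm x; rewrite leNgt; apply/negP => cx.
have xA : x \in A by apply: contraTT cx => /hA; rewrite -leNgt.
pose x0 : A := [` xA]%fset.
have [x1 _ max1] := @arg_maxP _ R A x0 predT (fun i => h (val i)) isT.
have {}max1 (j : A) : h (val j) <= h (val x1) by exact: max1.
have cx1 : c < h (val x1) by apply: lt_le_trans cx (max1 x0).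
have maxh y : h y <= h (val x1).
  have [yA|/hA yc] := boolP (y \in A); first exact: (max1 [` yA]%fset).
  exact: le_trans yc (ltW cx1).
(* Among the maximizers of [h], take one farthest from [x]. *)
have [x2 /eqP hx2 max2] :=
  @arg_maxnP _ x1 (fun i => h (val i) == h (val x1)) (fun i => dist x (val i)) (eqxx _).
have [y xy] := exists_child x (val x2).
have : \sum_(y <- neighbors (val x2)) (h (val x2) - h y) == 0.
  by rewrite harm //; exact: valP.
rewrite psumr_eq0 => [|z _]; last by rewrite subr_ge0 hx2.
move/allP/(_ y); rewrite in_neighbors xy => /(_ isT) /=.
rewrite subr_eq0 hx2 => /eqP hy.
have yA : y \in A.
  by apply: contraTT cx1 => /hA; rewrite -leNgt hy.
rewrite ltnNge => /negP; apply; apply: (max2 [` yA]%fset).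
by rewrite /= hy.
Qed.

End TreeDistance.

(** * Currents and voltages of the contracted network, read on the tree *)

Section WiredCurrent.
Variables (R : realType) (q : nat) (T : tree).
Hypothesis T_homogeneous : homogeneous T q.+1.
Variables (o : T) (G : finite_subgraph T).
Variables (i : oedge (wired R G) -> R) (v : node (wired R G) -> R).
Hypothesis iv : unit_current (wired_node R G o) (wired_sink R G) i v.

Let A := sub_verts G.

Lemma wired_nodeE x (xA : x \in A) : wired_node R G x = Some [` xA]%fset.
Proof. exact: insubT. Qed.

Lemma wired_node_out x : x \notin A -> wired_node R G x = wired_sink R G.
Proof. by move=> xA; apply: insubN. Qed.

(** Membership of [x] alone suffices: its image is a [Some], whereas all vertices outside [A] go to
    [None]. *)
Lemma wired_node_inj x y : x \in A -> wired_node R G x = wired_node R G y -> x = y.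
Proof.
move=> xA; rewrite wired_nodeE; have [yA|/wired_node_out ->//] := boolP (y \in A).
by rewrite wired_nodeE => -[].
Qed.

Lemma current_voltage (e : oedge (wired R G)) : i e = v (src e) - v (dst e).
Proof. by rewrite (ohm_law iv) invr1 mulr1. Qed.

(** Holds for every edge: one that the contraction discards has endpoints with the same image, so
    the default 0 agrees with the voltage drop. *)
Lemma current_atE x y (xy : adj x y) :
  current_at i xy = v (wired_node R G x) - v (wired_node R G y).
Proof.
rewrite /current_at; case: insubP => [e _ ee|].
  by rewrite /= current_voltage /src /dst /= ee.
by rewrite negbK => /eqP; rewrite /wired_node /= => ->; rewrite subrr.
Qed.

(** Sending an edge to its head in the tree is a bijection from the edges leaving the image of [x]
    to the neighbours of [x], since parallel edges into the sink stay distinct. *)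
Lemma sum_current x : x \in A ->
  \sum_(e \in [set e : oedge (wired R G) | src e = wired_node R G x]) i e =
  \sum_(y <- neighbors x) (v (wired_node R G x) - v (wired_node R G y)).
Proof.
move=> xA; rewrite -fsbig_finite; last exact: finite_neighbors.
rewrite (@reindex_fsbig _ _ _ _ _
  (fun e : oedge (wired R G) => (val (val e)).2)
  [set e | src e = wired_node R G x]).
  by apply: eq_fsbigr => e; rewrite inE /= current_voltage => <-.
split.
- move=> e /= /esym/(wired_node_inj xA) ->; exact: (valP (val e)).
- move=> e e'; rewrite !inE /= => /esym/(wired_node_inj xA) ex.
  move=> /esym/(wired_node_inj xA) ex' ee.
  by apply/val_inj/val_inj; rewrite [LHS]surjective_pairing [RHS]surjective_pairing ee -ex -ex'.
- move=> y /= xy.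
  have ne : wired_node R G x != wired_node R G y.
    by apply/eqP => /(wired_node_inj xA) yx; move: xy; rewrite yx adj_irr.
  by exists (exist _ (mk_edge xy) ne : oedge (wired R G)).
Qed.

Lemma voltage_laplacian x : x \in A ->
  \sum_(y <- neighbors x) (v (wired_node R G x) - v (wired_node R G y)) = (x == o)%:R.
Proof.
move=> xA; rewrite -sum_current //.
have [->|xo] := eqVneq x o; first exact: (current_unit iv).
apply: (kirchhoff_law iv); last by rewrite wired_nodeE.
by apply: contraNneq xo => /(wired_node_inj xA) ->.
Qed.

(** * The Green function of the tree and its comparison with the voltage *)

Hypothesis q_ge2 : (2 <= q)%N.

(** The Green function with pole at [o], written in terms of the distance so that the neighbour sums
    apply. The constant factor normalizes the flow out of [o] to 1. *)
Definition tree_green (n : nat) : R := q%:R / (q%:R ^+ 2 - 1) * q%:R ^- n.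

Lemma q_gt1 : 1 < q%:R :> R.
Proof. by rewrite ltr1n. Qed.

Lemma tree_green_ge0 n : 0 <= tree_green n.
Proof.
have q1 := q_gt1.
rewrite mulr_ge0 ?invr_ge0 ?exprn_ge0 // divr_ge0 // subr_ge0 expr_ge1 //.
exact: ltW.
Qed.

(** This is the unit flow shared equally by the [(q + 1) q^n] edges from level [n] to level
    [n + 1]. *)
Lemma tree_greenB n : tree_green n - tree_green n.+1 = 1 / (q%:R + 1) * (1 / q%:R ^+ n).
Proof.
have q1 := q_gt1; rewrite /tree_green (exprS _ n).
have qn : q%:R ^+ n != 0 :> R by rewrite expf_neq0 //; lra.
field; rewrite qn /=; apply/and3P; split; nra.
Qed.

Lemma tree_green_laplacian x :
  \sum_(y <- neighbors x) (tree_green (dist o x) - tree_green (dist o y)) = (x == o)%:R.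
Proof.
have q1 := q_gt1.
have [->|xo] := eqVneq x o.
  rewrite (sum_neighbors_root T_homogeneous (fun n => tree_green (dist o o) - tree_green n)).
  rewrite dist_refl tree_greenB -[_ *+ q.+1]mulr_natr -[q.+1%:R]natr1 expr0 mulr1n.
  by field; lra.
have [z xz dz] := dist_parent xo; rewrite dz.
rewrite (sum_neighbors T_homogeneous (fun n => tree_green (dist o z).+1 - tree_green n) dz).
(* The drop towards the parent is negative and cancels the [q] equal drops towards the children. *)
rewrite -opprB !tree_greenB -[(_ * _) *+ q]mulr_natr (exprS _ (dist o z)).
have qn : q%:R ^+ dist o z != 0 :> R by rewrite expf_neq0 //; lra.
by rewrite mulr0n; field; rewrite qn /=; lra.
Qed.

Lemma voltage_approx (c : R) : 0 <= c ->
  (forall x, x \notin A -> tree_green (dist o x) <= c) ->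
  forall x, `|tree_green (dist o x) - v (wired_node R G x)| <= c.
Proof.
move=> c0 gc x.
have q_gt0 : (0 < q)%N by apply: leq_trans q_ge2.
have vout y : y \notin A -> v (wired_node R G y) = 0.
  by move=> /wired_node_out ->; exact: (voltage_ground iv).
(* The unit sources at [o] cancel in the difference. *)
have harm y : y \in A -> \sum_(z <- neighbors y)
    ((tree_green (dist o y) - v (wired_node R G y)) -
     (tree_green (dist o z) - v (wired_node R G z))) = 0.
  move=> yA; under eq_bigr => z _ do rewrite opprD addrACA -opprD.
  by rewrite sumrB tree_green_laplacian voltage_laplacian // subrr.
rewrite ler_norml lerNl; apply/andP; split; last first.
  apply: (maximum_principle T_homogeneous q_gt0 (A := A)
    (h := fun y => tree_green (dist o y) - v (wired_node R G y))) => // y yA.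
  by rewrite vout // subr0 gc.
(* For the opposite function the values outside [A] are at most 0, hence at most [c], because
   [tree_green] is nonnegative. *)
apply: (maximum_principle T_homogeneous q_gt0 (A := A)
    (h := fun y => - (tree_green (dist o y) - v (wired_node R G y)))) => y yA.
  by rewrite vout // subr0 (le_trans _ c0) // oppr_le0 tree_green_ge0.
by under eq_bigr => z _ do rewrite -opprD; rewrite sumrN harm // oppr0.
Qed.

End WiredCurrent.

(** * Passage to the limit along the exhaustion *)

Lemma tree_green_cvg0 (R : realType) (q : nat) : (2 <= q)%N ->
  tree_green R q n @[n --> \oo] --> 0.
Proof.
move=> q_ge2; have q1 := q_gt1 R q_ge2.
have : `|q%:R^-1 : R| < 1.
  by rewrite ger0_norm ?invr_ge0 // invf_lt1 //; lra.
move=> /(cvg_geometric (q%:R / (q%:R ^+ 2 - 1))).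
rewrite (_ : geometric _ _ = tree_green R q) //.
by apply/funext => n; rewrite /tree_green -exprVn.
Qed.

Lemma tree_green_homo (R : realType) (q : nat) : (2 <= q)%N ->
  {homo tree_green R q : m n / (m <= n)%N >-> n <= m}.
Proof.
move=> q_ge2 m n mn; have q1 := q_gt1 R q_ge2.
rewrite ler_wpM2l //; first by rewrite divr_ge0 // subr_ge0 expr_ge1 // ltW.
by rewrite lef_pV2 ?posrE ?exprn_gt0 ?ler_weXn2l //; lra.
Qed.

(** The ball is finite, so the largest of the indices at which its vertices have entered the
    increasing sequence works for all of them. *)
Lemma exhaustion_ball (T : tree) (q : nat) (o : T) (G : nat -> finite_subgraph T) :
  homogeneous T q.+1 -> exhaustion o G -> forall m,
  \forall n \near \oo, forall x, (dist o x <= m)%N -> x \in sub_verts (G n).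
Proof.
move=> Th Gex m; have ballf := finite_ball Th o m.
have /choice[k kP] := exhaustion_verts Gex.
exists (\max_(x <- fset_set [set x | (dist o x <= m)%N]) k x) => // n /= kn x xm.
have kxn : (k x <= n)%N.
  by apply: leq_trans kn; apply: leq_bigmax_seq => //; rewrite in_fset_set ?inE.
by have [+ _] := exhaustion_incr Gex kxn; apply.
Qed.

Theorem proposition7p1 (R : realType) (q : nat) (q_ge2 : (2 <= q)%N)
    (T : tree) (T_homogeneous : homogeneous T q.+1) (o : T)
    (G : nat -> finite_subgraph T) (G_exhaustion : exhaustion o G)
    (i : forall n : nat, oedge (wired R (G n)) -> R)
    (v : forall n : nat, node (wired R (G n)) -> R)
    (iv_current : forall n : nat,
       unit_current (wired_node R (G n) o) (wired_sink R (G n)) (i n) (v n)) :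
  (forall (x y : T) (xy : adj x y),
     ((dist o x < dist o y)%N ->
        current_at (i n) xy @[n --> \oo] -->
          (1 / (q%:R + 1) * (1 / q%:R ^+ dist o x) : R)) /\
     ((dist o y < dist o x)%N ->
        current_at (i n) xy @[n --> \oo] -->
          (- (1 / (q%:R + 1) * (1 / q%:R ^+ (dist o x - 1))) : R))) /\
  (forall x : T,
     v n (wired_node R (G n) x) @[n --> \oo] -->
       (q%:R / (q%:R ^+ 2 - 1) * q%:R ^- dist o x : R)).
Proof.
have v_cvg x : v n (wired_node R (G n) x) @[n --> \oo] --> tree_green R q (dist o x).
  apply/cvgrPdist_le => e e0.
  (* [m] is a radius from which [tree_green] is at most [e]; once [G n] contains the ball of radius
     [m], this bounds [tree_green] at every vertex outside [G n]. *)
  have /cvgrPdist_le/(_ _ e0)[m _ gm] := tree_green_cvg0 (R := R) q_ge2.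
  have ge : tree_green R q m <= e.
    have := gm m (leqnn m); rewrite sub0r normrN ger0_norm //.
    exact: tree_green_ge0.
  near=> n.
  apply: (voltage_approx T_homogeneous (iv_current n)) => //.
    exact: ltW.
  move=> y yA; apply: le_trans ge; apply: tree_green_homo => //.
  rewrite leqNgt; apply: contra yA => ym.
  suff : forall y, (dist o y <= m)%N -> y \in sub_verts (G n) by apply; exact: ltnW.
  by near: n; exact: exhaustion_ball T_homogeneous G_exhaustion m.
have i_cvg x y (xy : adj x y) : current_at (i n) xy @[n --> \oo] -->
    tree_green R q (dist o x) - tree_green R q (dist o y).
  under eq_fun => n do rewrite (current_atE (iv_current n)).
  exact: cvgB.
split=> [x y xy|]; last exact: v_cvg.
split=> xy_lt; have := i_cvg x y xy.
  by rewrite (dist_adj_lt xy) // tree_greenB.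
(* Now [y] is the parent of [x]: the drop changes sign and the exponent [dist o x - 1] is
   [dist o y]. *)
have yx : adj y x by rewrite adj_sym.
by rewrite (dist_adj_lt yx) // -opprB tree_greenB // subn1.
Unshelve. all: by end_near. Qed.
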